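(* Let $\mathcal{D}=\{(\Sigma_k,L_k,G_k)\}_{k\in\mathbb{N}}$ be a treelike decomposition class with automation $\mathcal{A}=\{A_k\}_k$, and let $C$ be a $\mathcal{D}$-coherent treelike DP-core. For each $k\in\mathbb{N}$, $P(\mathcal{D}_k)\not\subseteq P(C,\mathcal{D})$ if and only if some $(\mathcal{A},C,k)$-refutation exists.
   Context: Graphs: triples $G=(V,E,I)$, $V,E$ finite subsets of $\mathbb{N}$, $I\subseteq E\times V$; $\simeq$ isomorphism; isomorphism closure of a set of graphs = all graphs isomorphic to one of its members. Terms over a ranked alphabet: finite rooted ordered labelled trees (arity = number of children). A tree automaton has states, final states and transitions $a(q_1,\dots,q_p)\to q$ for symbols $a$ of arity $p$ ($a\to q$ for arity $0$). Treelike decomposition class: $\mathcal{D}=\{(\Sigma_k,L_k,G_k)\}_{k}$, $\Sigma_k$ ranked alphabet, $L_k$ regular tree language over $\Sigma_k$, $G_k:L_k\to$ graphs, $\Sigma_k\subseteq\Sigma_{k+1}$, $L_k\subseteq L_{k+1}$, $G_{k+1}|_{L_k}=G_k$; $G(\tau)=G_k(\tau)$; $P(\mathcal{D}_k)$ = isomorphism closure of $\{G(\tau):\tau\in L_k\}$. An automation is a sequence of tree automata $A_k$ over $\Sigma_k$ accepting exactly $L_k$. Treelike DP-core $C=\{C[k]\}$, $C[k]=(\Sigma_k,W_k,F_k,T_k,\mathrm{Clean}_k,\mathrm{Inv}_k)$: $W_k\subseteq\{0,1\}^*$ decidable; $F_k:W_k\to\{0,1\}$ ($w$ final iff $F_k(w)=1$);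 a finite $\hat a\subseteq W_k$ for each arity-$0$ $a$; $\hat a:W_k^p\to$ finite subsets of $W_k$ for arity $p\ge1$; $\mathrm{Clean}_k$ finite subsets $\to$ finite subsets; $\mathrm{Inv}_k$ finite subsets $\to\{0,1\}^*$. $\hat a(S_1,\dots,S_p)=\mathrm{Clean}_k(\bigcup_{w_i\in S_i}\hat a(w_1,\dots,w_p))$. $\mathrm{Dyn}_k(a)=\hat a$ (arity 0), $\mathrm{Dyn}_k(a(\tau_1,\dots,\tau_p))=\hat a(\mathrm{Dyn}_k(\tau_1),\dots,\mathrm{Dyn}_k(\tau_p))$; $\tau$ accepted by $C[k]$ iff $\mathrm{Dyn}_k(\tau)$ has a final witness. $P(C,\mathcal{D})$ = isomorphism closure of $\{G(\tau):\tau\in L_k$ accepted by $C[k]$, some $k\}$. $\mathcal{D}$-coherent: alphabets of $C$ are the $\Sigma_k$, and for $\tau\in L_k,\tau'\in L_{k'}$ with $G(\tau)\simeq G(\tau')$: acceptance by $C[k]$ and $C[k']$ agree, and $\mathrm{Inv}_k(\mathrm{Dyn}_k(\tau))=\mathrm{Inv}_{k'}(\mathrm{Dyn}_{k'}(\tau'))$. Refutations: an $(\mathcal{A},C,k)$-pair is $(q,S)$ with $q$ a state of $A_k$ and $S\subseteq W_k$; it is inconsistent if $q$ is final in $A_k$ but $S$ has no final witness. An $(\mathcal{A},C,k)$-refutation is a sequence of pairs $(q_1,S_1)\dots(q_m,S_m)$ such that $(q_m,S_m)$ is inconsistent and for each $i\in[m]$ either $(q_i,S_i)=(q,\hat a)$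 for an arity-$0$ symbol $a\in\Sigma_k$ with $a\to q$ a transition of $A_k$, or $(q_i,S_i)=(q,\hat a(S_{j_1},\dots,S_{j_p}))$ for some $j_1,\dots,j_p<i$, a symbol $a\in\Sigma_k$ of arity $p>0$ and a transition $a(q_{j_1},\dots,q_{j_p})\to q$ of $A_k$. *)

(* Defs.v *)
From mathcomp Require Import all_boot.
From mathcomp Require Import finmap.
From Stdlib Require List.

Set Implicit Arguments.
Unset Strict Implicit.
Unset Printing Implicit Defensive.

Local Open Scope fset_scope.

Record graph := Graph {
  vertices : {fset nat};
  edges : {fset nat};
  incid : {fset nat * nat};
  incidP : incid `<=` edges `*` vertices }.

Definition graph_iso (G H : graph) : Prop :=
  exists f g : nat -> nat,
    [/\ {in vertices G &, injective f}, f @` vertices G = vertices H,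
        {in edges G &, injective g}, g @` edges G = edges H
      & forall e v, e \in edges G -> v \in vertices G ->
          ((e, v) \in incid G) = ((g e, f v) \in incid H)].

Definition iso_closure (P : graph -> Prop) (H : graph) : Prop :=
  exists G, P G /\ graph_iso G H.

(* A finite alphabet together with its arity function: the finite map sends
   each symbol of the alphabet to its arity. *)
Definition ranked_alphabet (Sym : choiceType) := {fmap Sym -> nat}.

Definition has_arity (Sym : choiceType) (Sigma : ranked_alphabet Sym)
    (a : Sym) (p : nat) : Prop :=
  Sigma.[? a]%fmap = Some p.

Definition sub_alphabet (Sym : choiceType) (Sigma Sigma' : ranked_alphabet Sym)
    : Prop :=
  forall a p, has_arity Sigma a p -> has_arity Sigma' a p.

(* Ordered labelled trees. No alphabet is imposed here: the trees accepted by
   an automaton over Sigma are terms over Sigma because of [transP] below. *)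
Inductive tree (Sym : Type) : Type := Node of Sym & seq (tree Sym).

Record tree_automaton (Sym : choiceType) (Sigma : ranked_alphabet Sym) :=
  TreeAutomaton {
    state : finType;
    final_states : {set state};
    (* (a, [:: q_1; ...; q_p], q) stands for a(q_1, ..., q_p) -> q *)
    trans : {fset Sym * seq state * state};
    transP : forall a qs q,
      (a, qs, q) \in trans -> has_arity Sigma a (size qs) }.

Inductive reaches (Sym : choiceType) (Sigma : ranked_alphabet Sym)
    (A : tree_automaton Sigma) : tree Sym -> state A -> Prop :=
  Reaches a ts qs q of
    (a, qs, q) \in trans A & List.Forall2 (@reaches Sym Sigma A) ts qs :
    reaches (Node a ts) q.

Definition ta_accepts (Sym : choiceType) (Sigma : ranked_alphabet Sym)
    (A : tree_automaton Sigma) (t : tree Sym) : Prop :=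
  exists2 q, q \in final_states A & reaches t q.

Definition recognizes (Sym : choiceType) (Sigma : ranked_alphabet Sym)
    (A : tree_automaton Sigma) (L : tree Sym -> Prop) : Prop :=
  forall t, ta_accepts A t <-> L t.

Definition regular (Sym : choiceType) (Sigma : ranked_alphabet Sym)
    (L : tree Sym -> Prop) : Prop :=
  exists A : tree_automaton Sigma, recognizes A L.

(* [dc_graph D k] is total for convenience; it is only meaningful on
   [dc_lang D k], and nothing is assumed about its values elsewhere. *)
Record decomp_class (Sym : choiceType) := DecompClass {
  dc_alph : nat -> ranked_alphabet Sym;
  dc_lang : nat -> tree Sym -> Prop;
  dc_graph : nat -> tree Sym -> graph;
  dc_regular : forall k, regular (dc_alph k) (dc_lang k);
  dc_alph_sub : forall k, sub_alphabet (dc_alph k) (dc_alph k.+1);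
  dc_lang_sub : forall k t, dc_lang k t -> dc_lang k.+1 t;
  dc_graph_ext : forall k t, dc_lang k t -> dc_graph k.+1 t = dc_graph k t }.

Definition automation (Sym : choiceType) (D : decomp_class Sym)
    (A : forall k, tree_automaton (dc_alph D k)) : Prop :=
  forall k, recognizes (A k) (dc_lang D k).

Definition graph_property (Sym : choiceType) (D : decomp_class Sym) (k : nat)
    : graph -> Prop :=
  iso_closure (fun G => exists2 t, dc_lang D k t & G = dc_graph D k t).

(* Decidable subsets of {0,1}^* are those whose characteristic function is
   recursive (Kleene), words being coded by bijective binary numeration.
   A bool-valued predicate alone would not express this in the presence of
   classical axioms. *)
Inductive recfun : Type :=
  | RZero
  | RSucc
  | RProj of nat
  | RComp of recfun & seq recfun
  | RPrec of recfun & recfun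
  | RMu of recfun.

Inductive computes : recfun -> seq nat -> nat -> Prop :=
  | CZero xs : computes RZero xs 0
  | CSucc x : computes RSucc [:: x] x.+1
  | CProj i xs of i < size xs : computes (RProj i) xs (nth 0 xs i)
  | CComp f gs xs ys y of
      List.Forall2 (fun g z => computes g xs z) gs ys & computes f ys y :
      computes (RComp f gs) xs y
  | CPrec0 f g xs y of computes f xs y : computes (RPrec f g) (0 :: xs) y
  | CPrecS f g n xs r y of
      computes (RPrec f g) (n :: xs) r & computes g [:: n, r & xs] y :
      computes (RPrec f g) (n.+1 :: xs) y
  | CMu f xs n of
      computes f (n :: xs) 0 &
      (forall i, i < n -> exists y, computes f (i :: xs) y.+1) :
      computes (RMu f) xs n.

Definition word_code (w : bitseq) : nat :=
  foldr (fun (b : bool) n => (b + n.*2).+1) 0 w.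

Definition decidable_lang (W : pred bitseq) : Prop :=
  exists f, forall w, computes f [:: word_code w] (W w).

(* One level C[k]. [core_step a [:: w_1; ...; w_p]] is \hat a(w_1, ..., w_p)
   for a of arity p in the alphabet, and [core_step a [::]] is \hat a for a of
   arity 0; other values of [core_step] are never used. *)
Record core_level (Sym : choiceType) := CoreLevel {
  core_alph : ranked_alphabet Sym;
  core_wit : pred bitseq;
  core_wit_dec : decidable_lang core_wit;
  core_final : {w : bitseq | core_wit w} -> bool;
  core_step : Sym -> seq {w : bitseq | core_wit w} ->
    {fset {w : bitseq | core_wit w}};
  core_clean : {fset {w : bitseq | core_wit w}} ->
    {fset {w : bitseq | core_wit w}};
  core_inv : {fset {w : bitseq | core_wit w}} -> bitseq }.

Notation witness K := {w : bitseq | core_wit K w}.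

Definition dp_core (Sym : choiceType) := nat -> core_level Sym.

(* All [:: w_1; ...; w_p] with w_i \in S_i, for Ss = [:: S_1; ...; S_p]. *)
Definition choices (T : choiceType) (Ss : seq {fset T}) : seq (seq T) :=
  foldr (fun (S : {fset T}) wss => [seq w :: ws | w <- S, ws <- wss])
    [:: [::]] Ss.

Lemma mem_choices (T : choiceType) (Ss : seq {fset T}) (ws : seq T) :
  (ws \in choices Ss) = all2 (fun w (S : {fset T}) => w \in S) ws Ss.
Proof.
elim: Ss ws => [|S Ss IH] [|w ws] //=.
  by apply/negbTE/negP => /allpairsP[[u us] [_ _ //]].
rewrite -IH; apply/allpairsP/andP => [[[u us] /= [uS usS [-> ->]]]|[wS wsS]] //.
by exists (w, ws).
Qed.

Definition lift_step (Sym : choiceType) (K : core_level Sym) (a : Sym)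
    (Ss : seq {fset witness K}) : {fset witness K} :=
  core_clean (\bigcup_(ws <- choices Ss) core_step a ws).

(* Clean is not applied at the leaves. *)
Fixpoint dyn (Sym : choiceType) (K : core_level Sym) (t : tree Sym)
    : {fset witness K} :=
  let: Node a ts := t in
  if ts is [::] then core_step a [::] else lift_step a (map (dyn K) ts).

Definition has_final (Sym : choiceType) (K : core_level Sym)
    (S : {fset witness K}) : Prop :=
  exists2 w, w \in S & core_final w.

Definition core_accepts (Sym : choiceType) (K : core_level Sym) (t : tree Sym)
    : Prop :=
  has_final (dyn K t).

Definition core_property (Sym : choiceType) (C : dp_core Sym)
    (D : decomp_class Sym) : graph -> Prop :=
  iso_closure (fun G => exists k t,
    [/\ dc_lang D k t, core_accepts (C k) t & G = dc_graph D k t]).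

Definition coherent (Sym : choiceType) (D : decomp_class Sym) (C : dp_core Sym)
    : Prop :=
  (forall k, core_alph (C k) = dc_alph D k) /\
  (forall k k' t t', dc_lang D k t -> dc_lang D k' t' ->
     graph_iso (dc_graph D k t) (dc_graph D k' t') ->
     (core_accepts (C k) t <-> core_accepts (C k') t') /\
     core_inv (dyn (C k) t) = core_inv (dyn (C k') t')).

Definition ref_pair (Sym : choiceType) (Sigma : ranked_alphabet Sym)
    (A : tree_automaton Sigma) (K : core_level Sym) : Type :=
  (state A * {fset witness K})%type.

Definition inconsistent (Sym : choiceType) (Sigma : ranked_alphabet Sym)
    (A : tree_automaton Sigma) (K : core_level Sym) (x : ref_pair A K) : Prop :=
  x.1 \in final_states A /\ ~ has_final x.2.

Definition refutation (Sym : choiceType) (Sigma : ranked_alphabet Sym)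
    (A : tree_automaton Sigma) (K : core_level Sym) (m : nat)
    (x : (m.+1).-tuple (ref_pair A K)) : Prop :=
  inconsistent (tnth x ord_max) /\
  forall i : 'I_m.+1,
    (exists a : Sym,
      [/\ has_arity Sigma a 0, (a, [::], (tnth x i).1) \in trans A
        & (tnth x i).2 = core_step a [::]]) \/
    (exists (a : Sym) (p : nat) (j : p.-tuple 'I_m.+1),
      [/\ 0 < p, has_arity Sigma a p, (forall l, tnth j l < i),
          (a, [seq (tnth x h).1 | h <- j], (tnth x i).1) \in trans A
        & (tnth x i).2 = lift_step a [seq (tnth x h).2 | h <- j]]).

(* Main.v *)
Require Import Defs.
From mathcomp Require Import all_boot.
From mathcomp Require Import finmap.
From Stdlib Require List.
From Stdlib Require Import Classical.

(** By coherence, [P(D_k)] is not included in [P(C, D)] exactly when some term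
    of [L_k] is rejected by [C[k]]. Refutations encode such terms: a pair can
    occur in a sequence satisfying the rules iff it is [(q, Dyn_k(t))] for a term
    [t] from which [A_k] reaches [q]. One direction reads terms off the
    positions by strong induction, the other concatenates the sequences obtained
    for the immediate subterms and appends the pair of the root. *)

Set Implicit Arguments.
Unset Strict Implicit.
Unset Printing Implicit Defensive.

Lemma graph_iso_refl (G : graph) : graph_iso G G.
Proof.
exists id, id; split=> //.
- by apply/fsetP => v; apply/imfsetP/idP => [[u uG ->]//|vG]; exists v.
- by apply/fsetP => v; apply/imfsetP/idP => [[u uG ->]//|vG]; exists v.
Qed.

(** For [t] in [L_k], membership of its graph in [P(C, D)] only yields an accepted term at some
    level [k'] with an isomorphic graph; coherence transfers acceptance back to [t] at level [k]. *)
Lemma graph_property_subset (Sym : choiceType) (D : decomp_class Sym)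
    (C : dp_core Sym) (k : nat) : coherent D C ->
  (forall G, graph_property D k G -> core_property C D G) <->
  (forall t, dc_lang D k t -> core_accepts (C k) t).
Proof.
move=> [_ coh]; split=> [sub t Lt|acc H [_ [[t Lt ->] iso_tH]]].
  have [|_ [[k' [t' [Lt' acct' ->]]] iso_t't]] := sub (dc_graph D k t).
    by exists (dc_graph D k t); split; [exists t|exact: graph_iso_refl].
  by have [[+ _] _] := coh k' k t' t Lt' Lt iso_t't; apply.
by exists (dc_graph D k t); split=> //; exists k, t; split=> //; apply: acc.
Qed.

Section Derivations.

Variables (Sym : choiceType) (Sigma : ranked_alphabet Sym).
Variables (A : tree_automaton Sigma) (K : core_level Sym).

Implicit Types (x : ref_pair A K) (s p : seq (state A * {fset witness K})).

(** Premises are cited by membership instead of by position, so sequences can be concatenated and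
    weakened without renumbering. *)
Definition derivation_step p x : Prop :=
  (exists a : Sym, (a, [::], x.1) \in trans A /\ x.2 = core_step a [::]) \/
  (exists (a : Sym) (ys : seq (state A * {fset witness K})),
    [/\ 0 < size ys, {subset ys <= p}, (a, map fst ys, x.1) \in trans A
      & x.2 = lift_step a (map snd ys)]).

(* The elements of [p] are available as premises throughout [s]. *)
Fixpoint derivation p s : Prop :=
  if s is x :: s' then derivation_step p x /\ derivation (rcons p x) s'
  else True.

Lemma derivation_cat p s1 s2 :
  derivation p (s1 ++ s2) <-> derivation p s1 /\ derivation (p ++ s1) s2.
Proof.
elim: s1 p => [|x s1 IH] p /=; first by rewrite cats0; tauto.
by rewrite IH cat_rcons; tauto.
Qed.

Lemma derivation_step_mono p p' x :
  {subset p <= p'} -> derivation_step p x -> derivation_step p' x.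
Proof.
move=> pp' [leaf|[a [ys [ys0 ysp tr eqx]]]]; [by left|right].
by exists a, ys; split=> // y /ysp/pp'.
Qed.

Lemma derivation_mono p p' s :
  {subset p <= p'} -> derivation p s -> derivation p' s.
Proof.
elim: s p p' => //= x s IH p p' pp' [stx ders]; split.
  exact: derivation_step_mono stx.
apply: IH ders => y; rewrite !mem_rcons !inE => /orP[->//|/pp' ->].
by rewrite orbT.
Qed.

Lemma derivation_nth x0 s i : derivation [::] s -> i < size s ->
  derivation_step (take i s) (nth x0 s i).
Proof.
move=> + lt_i; rewrite -{1}(cat_take_drop i s) (drop_nth x0 lt_i).
by case/derivation_cat => _ /= [].
Qed.

Lemma reaches_derivation t (q : state A) : reaches t q ->
  exists s, derivation [::] (rcons s (q, dyn K t)).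
Proof.
(* A recursion on the proof of [reaches] is written by hand, because the subproofs for the children
   are nested inside [List.Forall2]. *)
move: t q; fix IH 3 => t q [{t q} a ts qs q tr H].
have [s [ders ins]] : exists s,
    derivation [::] s /\ {subset zip qs (map (dyn K) ts) <= s}.
  elim: {tr} H => [|t1 q1 ts1 qs1 r1 _ [s [ders ins]]]; first by exists [::].
  have [s1 ders1] := IH _ _ r1.
  (* The block for the first child needs no premises; the blocks for the others stay valid after it
     by weakening. *)
  exists (rcons s1 (q1, dyn K t1) ++ s); split.
    by apply/derivation_cat; split=> //; apply: derivation_mono ders.
  move=> y /=; rewrite inE mem_cat => /orP[/eqP->|/ins->].
    by rewrite mem_rcons mem_head.
  by rewrite orbT.
have sz : size qs = size (map (dyn K) ts).
  by rewrite size_map; elim: {tr ins IH} H => //= *; congr _.+1.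
exists s; rewrite -cats1; apply/derivation_cat; split=> //=; split=> //.
case: ts sz ins H => [|t1 ts] sz ins H.
  by left; exists a; split=> //; move: sz tr => /size0nil->.
right; exists a, (zip qs (map (dyn K) (t1 :: ts))); split=> //.
- by rewrite size_zip sz minnn.
- by rewrite -/unzip1 unzip1_zip ?sz.
- by rewrite -/unzip2 unzip2_zip ?sz.
Qed.

Lemma derivation_refutation s x : derivation [::] (rcons s x) ->
  inconsistent x ->
  exists (m : nat) (u : (m.+1).-tuple (ref_pair A K)), refutation u.
Proof.
move=> der incx; have sz : size (rcons s x) == (size s).+1 by rewrite size_rcons.
exists (size s), (Tuple sz); split.
  by rewrite (tnth_nth x) /= nth_rcons ltnn eqxx.
move=> i; rewrite (tnth_nth x) /=.
have lt_i : i < size (rcons s x) by rewrite (eqP sz).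
have [[a [tr eqx]]|[a [ys [ys0 ysp tr eqx]]]] := derivation_nth x der lt_i.
  by left; exists a; split=> //; apply: transP tr.
right.
(* Each premise is cited at its first occurrence. The default value of [inord] never arises for
   members of [ys], whose index is in range. *)
pose pos (y : state A * {fset witness K}) : 'I_(size s).+1 :=
  inord (index y (rcons s x)).
have pos_lt y : y \in ys -> index y (rcons s x) < i.
  (* A premise occurs in the prefix of length [i], hence so does its first occurrence. *)
  move=> /ysp yi; rewrite -{1}(cat_take_drop i (rcons s x)) index_cat yi.
  by rewrite -{2}(size_takel (ltnW lt_i)) index_mem.
have val_pos y : y \in ys -> pos y = index y (rcons s x) :> nat.
  by move=> /pos_lt lti; rewrite inordK // (ltn_trans lti).
have tnth_pos y : y \in ys -> tnth (Tuple sz) (pos y) = y.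
  move=> yys; rewrite (tnth_nth x) val_pos //= nth_index //.
  exact: mem_take (ysp _ yys).
exists a, (size ys), (map_tuple pos (in_tuple ys)); split=> //.
- by have := transP tr; rewrite size_map.
- by move=> l; rewrite tnth_map val_pos ?pos_lt // mem_tnth.
- suff -> : [seq (tnth (Tuple sz) h).1 | h <- map pos ys] = map fst ys by [].
  by rewrite -map_comp; apply/eq_in_map => y /tnth_pos /= ->.
- by rewrite eqx -map_comp; congr lift_step; apply/eq_in_map => y /tnth_pos /= ->.
Qed.

(** Gathers the terms found for the premises of one rule into the list of children of a new root;
    induction on [js] makes the finitely many choices. *)
Lemma reaches_seq (I : eqType) (f : I -> ref_pair A K) (js : seq I) :
  (forall h, h \in js -> exists2 t, reaches (A := A) t (f h).1 & (f h).2 = dyn K t) ->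
  exists2 ts, List.Forall2 (@reaches _ _ A) ts [seq (f h).1 | h <- js]
    & [seq (f h).2 | h <- js] = map (dyn K) ts.
Proof.
elim: js => [|h js IH] ex; first by exists [::].
have [t rt eqt] := ex h (mem_head h js).
have [|ts rts eqts] := IH; first by move=> g gj; apply: ex; rewrite inE gj orbT.
by exists (t :: ts) => /=; [apply: List.Forall2_cons | rewrite eqt eqts].
Qed.

Lemma refutation_reaches m (x : (m.+1).-tuple (ref_pair A K)) (i : 'I_m.+1) :
  refutation x ->
  exists2 t, reaches (A := A) t (tnth x i).1 & (tnth x i).2 = dyn K t.
Proof.
move=> [_ rules]; have [n] := ubnP (i : nat); elim: n i => // n IH i le_in.
have [[a [_ tr eqx]]|[a [p [j [p0 _ lt_j tr eqx]]]]] := rules i.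
  by exists (Node a [::]) => //; apply: Reaches tr _; apply: List.Forall2_nil.
have [h /tnthP[l ->]|ts rts eqts] := @reaches_seq _ (tnth x) j.
  by apply: IH; apply: leq_trans (lt_j l) _.
exists (Node a ts); first exact: Reaches tr rts.
(* Since [p] is positive, [ts] is nonempty, so [dyn] at the new root computes by [lift_step] and not
   by the leaf case, which skips the cleaning. *)
have : size ts = p by rewrite -(size_map (dyn K)) -eqts size_map size_tuple.
rewrite eqx eqts; case: ts {rts eqts} => [/= p_0|t ts _ //].
by rewrite -p_0 in p0.
Qed.

Lemma refutation_rejected :
  (exists (m : nat) (x : (m.+1).-tuple (ref_pair A K)), refutation x) <->
  exists2 t, ta_accepts A t & ~ core_accepts K t.
Proof.
split=> [[m [x refx]]|[t [q qF rt] rej]].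
  have [t rt eqt] := refutation_reaches ord_max refx.
  have [[qF rej] _] := refx.
  by exists t; [exists (tnth x ord_max).1 | rewrite /core_accepts -eqt].
have [s ders] := reaches_derivation rt.
exact: derivation_refutation ders _.
Qed.

End Derivations.

Theorem theorem5 (Sym : choiceType) (D : decomp_class Sym)
    (A : forall k : nat, tree_automaton (dc_alph D k)) (C : dp_core Sym)
    (hA : automation A) (hC : coherent D C) (k : nat) :
  ~ (forall G : graph, graph_property D k G -> core_property C D G) <->
  exists (m : nat) (x : (m.+1).-tuple (ref_pair (A k) (C k))), refutation x.
Proof.
rewrite graph_property_subset // refutation_rejected; split=> [nacc|[t At rej] acc].
  (* Classical reasoning turns the failure of universal acceptance into an actual rejected term. *)
  apply: NNPP => nex; apply: nacc => t Lt; apply: NNPP => rej; apply: nex.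
  by exists t => //; apply/hA.
by apply: rej; apply: acc; apply/hA.
Qed.
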